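(* Let $n\ge2$ and $p\in(0,1)$. The vector \[\psi_{\delta^{(n)}}=\sum_{\substack{w\in\mathfrak S_n\\ w^{-1}(1)<w^{-1}(n)}}\zeta_{\delta^{(n)}}(w,0)\,\big(e_{w^{-1}(1)}-e_{w^{-1}(n)}\big)\] is a positive scalar multiple of \[\sum_{1\le i<j\le n}\frac{(j-i)\,(2n-(i+j-1)p)}{(n-ip)(n-(i-1)p)(n-jp)(n-(j-1)p)}\,(e_i-e_j).\]
   Context: Type $A_{n-1}$ setting: $e_1,\dots,e_n$ is the standard basis of $\mathbb R^n$. $\mathfrak S_n$ is the symmetric group; for $i\in\mathbb Z/n\mathbb Z$, $\overline s_i\in\mathfrak S_n$ is the transposition swapping $i$ and $i+1$ (so $\overline s_0$ swaps $n$ and $1$), and $\overline s_iw$ denotes composition. For integers $k,k'$, $\mathfrak f_0(k,k')=1$ if $k>k'$ and $0$ otherwise. Let $\mathbf M_{\delta^{(n)}}$ be the Markov chain on $\mathfrak S_n\times\mathbb Z/n\mathbb Z$ with transition probabilities $\mathbb P((w,i)\to(\overline s_iw,i+1))=p\,\mathfrak f_0(w^{-1}(i),w^{-1}(i+1))$ and $\mathbb P((w,i)\to(w,i+1))=1-p\,\mathfrak f_0(w^{-1}(i),w^{-1}(i+1))$ (indices mod $n$, $w^{-1}(0):=w^{-1}(n)$, $w^{-1}(n+1):=w^{-1}(1)$), all others zero; $\zeta_{\delta^{(n)}}$ is its stationary distribution. (This chain is the toric projection of the affine Grassmannian reduced random combinatorial billiard trajectory in $\widetilde{\mathfrak S}_n$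 with initial direction $\delta^{(n)}=-ne_n+\sum_{j=1}^ne_j$, whose alcove word is $\cdots\mathsf c\mathsf c\mathsf c$ with $\mathsf c=s_{n-1}\cdots s_1s_0$, and $\psi_{\delta^{(n)}}$ is the vector governing the asymptotic direction of that trajectory.) *)

(* Defs.v *)
(* Convention: n = m.+1; the elements 1..n of [n] are
   encoded as 0..m in 'I_m.+1 (value a <-> ordinal a-1), and Z/nZ is
   encoded as 'I_m.+1 (class of i <-> ordinal i mod n). *)
From mathcomp Require Import all_boot all_order all_algebra all_fingroup.
Set Implicit Arguments. Unset Strict Implicit. Unset Printing Implicit Defensive.
Import Order.TTheory GRing.Theory Num.Theory.
Local Open Scope ring_scope.

Definition state (m : nat) : finType := ('S_m.+1 * 'I_m.+1)%type.

(* \bar s_i : swaps the values i and i+1 (mod n); for the class k = i mod n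
   these are the 0-indexed values (k-1 mod n) and k. *)
Definition sbar (m : nat) (k : 'I_m.+1) : 'S_m.+1 := tperm (ord_pred k) k.

Definition f0 (R : nzRingType) (a b : nat) : R := if (b < a)%N then 1 else 0.

Definition fw (R : nzRingType) (m : nat) (w : 'S_m.+1) (k : 'I_m.+1) : R :=
  @f0 R (val ((w^-1)%g (ord_pred k))) (val ((w^-1)%g k)).

(* transition probabilities; (w * s)%g is the function  s o w, i.e. \bar s_i w *)
Definition trans (R : nzRingType) (m : nat) (p : R) (x y : state m) : R :=
  let: (w, k) := x in
  (if y == ((w * sbar k)%g, ordS k) then p * @fw R m w k else 0)
  + (if y == (w, ordS k) then 1 - p * @fw R m w k else 0).

Definition stationary (R : numDomainType) (m : nat) (p : R) (zeta : state m -> R) :=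
  [/\ forall x, 0 <= zeta x,
      \sum_x zeta x = 1 &
      forall y, \sum_x zeta x * trans p x y = zeta y].

Definition e (R : nzRingType) (m : nat) (i : 'I_m.+1) : 'rV[R]_m.+1 := delta_mx 0 i.

Definition psi (R : nzRingType) (m : nat) (zeta : state m -> R) : 'rV[R]_m.+1 :=
  \sum_(w : 'S_m.+1 | ((w^-1)%g ord0 < (w^-1)%g ord_max)%N)
     zeta (w, ord0) *: (e R ((w^-1)%g ord0) - e R ((w^-1)%g ord_max)).

(* the explicit vector; i, j below are the 1-indexed values val i.+1, val j.+1 *)
Definition target (R : fieldType) (m : nat) (p : R) : 'rV[R]_m.+1 :=
  let n : R := (m.+1)%:R in
  \sum_(i < m.+1) \sum_(j < m.+1 | (i < j)%N)
    (((j.+1)%:R - (i.+1)%:R) * (2 * n - ((i.+1 + j.+1 - 1)%N)%:R * p)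
      / ((n - (i.+1)%:R * p) * (n - (i%:R) * p) * (n - (j.+1)%:R * p) * (n - (j%:R) * p)))
    *: (e R i - e R j).

(* Main.v *)
(* With D_i = (n - ip)(n - (i-1)p), the coefficient of e_i - e_j in the target is
   (1/D_j - 1/D_i)/p, and 1/D_i is itself a difference of consecutive values of
   1/(p(n - ip)), so the coordinates of the target have a closed form. The sum of
   the first k coordinates of psi is the probability that site 1 carries a type
   <= k and site n a type > k, which only depends on the set A of sites carrying
   types <= k. The lumped chain on such sets has the stationary weight 1 - p if A
   contains the left site of the bond about to be updated, and 1 otherwise.
   Uniqueness is an L2 argument: the energy of the density of a stationary measure
   against this weight cannot increase from one bond to the next, hence is constant
   along the cycle of bonds; no energy being dissipated, the density is invariant
   under all adjacent transpositions. *)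
Require Import Defs.
From mathcomp Require Import all_boot all_order all_algebra all_fingroup.
From mathcomp Require Import ring zify.
Import Order.TTheory GRing.Theory Num.Theory.
Local Open Scope ring_scope.

Set Implicit Arguments. Unset Strict Implicit. Unset Printing Implicit Defensive.

(** * Images of finite sets under permutations *)

Section Permutations.
Variable T : finType.
Implicit Types (s w : {perm T}) (A B : {set T}).

Lemma imset_permM w s A : (w * s)%g @: A = s @: (w @: A).
Proof. by rewrite -imset_comp; apply: eq_imset => x; rewrite /= permM. Qed.

Lemma mem_imset_perm w A x : (x \in w @: A) = ((w^-1)%g x \in A).
Proof. by rewrite -{1}(permKV w x) mem_imset //; exact: perm_inj. Qed.

Lemma imset_tperm_id x y A : (x \in A) = (y \in A) -> tperm x y @: A = A.
Proof.
move=> xy; apply/setP=> z; rewrite mem_imset_perm tpermV.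
by case: tpermP => [->|->|].
Qed.

Lemma imset_tpermK x y A : tperm x y @: (tperm x y @: A) = A.
Proof.
rewrite -imset_permM tperm2; apply/setP=> z.
by rewrite mem_imset_perm invg1 perm1.
Qed.

(** Induction on the size of [A :\: B]: transposing some [x] in [A :\: B] with some [y] in [B :\: A]
    removes [x] from the difference and adds nothing to it. *)
Lemma exists_imset_perm A B : #|A| = #|B| -> exists w, w @: A = B.
Proof.
move: {2}#|A :\: B| (leqnn #|A :\: B|) => d.
elim: d A => [|d IH] A hd AB.
  move: hd; rewrite leqn0 cards_eq0 setD_eq0 => sAB.
  exists 1%g; have <- : A = B by apply/eqP; rewrite eqEcard sAB AB leqnn.
  by apply/setP=> z; rewrite mem_imset_perm invg1 perm1.
have [/eqP D0|[x xAB]] := set_0Vmem (A :\: B).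
  by apply: IH => //; move: D0; rewrite -cards_eq0 => /eqP ->.
have [D0|[y yBA]] := set_0Vmem (B :\: A).
  move: xAB; rewrite inE => /andP[/negP xB xA]; case: xB.
  suff -> : B = A by [].
  by apply/eqP; rewrite eqEcard -setD_eq0 D0 eqxx AB leqnn.
have [w ww] : exists w, w @: (tperm x y @: A) = B.
  apply: IH; last by rewrite card_imset //; exact: perm_inj.
  rewrite -ltnS; apply: leq_trans hd; apply: proper_card.
  apply/properP; split.
    apply/subsetP => z; rewrite !inE mem_imset_perm tpermV => /andP[zB].
    rewrite zB; case: tpermP => // E.
      by move: yBA; rewrite inE => /andP[/negbTE ->].
    by move: yBA zB; rewrite E inE => /andP[_ ->].
  exists x => //; rewrite !inE mem_imset_perm tpermV tpermL.
  by move: yBA; rewrite inE => /andP[/negbTE -> _]; rewrite andbF.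
by exists (tperm x y * w)%g; rewrite imset_permM.
Qed.

End Permutations.

Lemma subset_setC1 (T : finType) (A : {set T}) x :
  (A \subset [set~ x]) = (x \notin A).
Proof. by rewrite -setTD subsetD1 subsetT. Qed.

(** Pascal's rule: among the [j.+1]-subsets of [B], those avoiding [x] are the [j.+1]-subsets of
    [B :\ x]; cancelling them leaves the count. *)
Lemma card_draws_in (T : finType) (B : {set T}) (x : T) j : x \in B ->
  #|[set A : {set T} | [&& x \in A, A \subset B & #|A| == j.+1]]|
  = 'C(#|B|.-1, j).
Proof.
move=> xB; have := cards_draws B j.+1.
rewrite -(cardsID [set A : {set T} | x \in A]).
have -> : [set A : {set T} | A \subset B & #|A| == j.+1]
      :\: [set A : {set T} | x \in A]
    = [set A : {set T} | A \subset B :\ x & #|A| == j.+1].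
  by apply/setP => A; rewrite !inE subsetD1 andbCA andbA.
rewrite cards_draws (cardsD1 x B) xB /= add1n binS addnC => /addnI <-.
by apply: eq_card => A; rewrite !inE andbC.
Qed.

(** * The cycle of sites and its adjacent transpositions *)

Lemma ord_pred0 m : ord_pred (ord0 : 'I_m.+1) = ord_max.
Proof. by apply: val_inj; rewrite /= modn_small. Qed.

Lemma ord_pred_neq m (c : 'I_m.+1) : (0 < m)%N -> ord_pred c != c.
Proof.
move=> m0; apply/eqP => /(congr1 val) /=.
case: c => [[|c] hc] /=.
  by rewrite modn_small // => E; rewrite E in m0.
rewrite modnDr modn_small ?(ltn_trans _ hc) //.
by move/eqP; rewrite ltn_eqF.
Qed.

Lemma iter_ordS_connected m (x y : 'I_m.+1) : exists d, y = iter d (@ordS _) x.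
Proof.
have iterS d : val (iter d (@ordS _) x) = ((x + d) %% m.+1)%N.
  elim: d => [|d IH] /=; first by rewrite addn0 modn_small.
  by rewrite IH -addn1 modnDml addn1 addnS.
exists (m.+1 - x + y)%N; apply: val_inj; rewrite iterS addnA subnKC.
  by rewrite modnDl modn_small.
exact: ltnW.
Qed.

Lemma ordS_invariant m (X : Type) (F : 'I_m.+1 -> X) :
  (forall c, F (ordS c) = F c) -> forall c d, F c = F d.
Proof.
move=> FS c d; have [k ->] := iter_ordS_connected c d.
by elim: k => //= k ->; rewrite FS.
Qed.

(** Adjacent transpositions generate the symmetric group: [tperm x (ordS z)] is [tperm x z]
    conjugated by [tperm z (ordS z)], which permits induction on the number of steps from [x] to [y]
    around the cycle. *)
Lemma invariant_adjacent m (X : Type) (h : {set 'I_m.+1} -> X) :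
  (forall c (A : {set 'I_m.+1}), h (sbar c @: A) = h A) ->
  forall (w : 'S_m.+1) (A : {set 'I_m.+1}), h (w @: A) = h A.
Proof.
move=> hs.
pose inv (u : 'S_m.+1) := forall A : {set 'I_m.+1}, h (u @: A) = h A.
have invM u v : inv u -> inv v -> inv (u * v)%g.
  by move=> hu hv A; rewrite imset_permM hv hu.
have inv1 : inv 1%g.
  by move=> A; congr h; apply/setP => z; rewrite mem_imset_perm invg1 perm1.
have invt d (x y : 'I_m.+1) : y = iter d (@ordS _) x -> inv (tperm x y).
  elim: d x y => [|d IH] x y /= ->; first by rewrite tperm1.
  set z := iter d _ x.
  have [<-|xz] := eqVneq x (ordS z); first by rewrite tperm1.
  have sz : sbar (ordS z) = tperm z (ordS z) by rewrite /sbar ordSK.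
  have [<-|zx] := eqVneq z x; first by rewrite -sz; exact: hs.
  have -> : tperm x (ordS z) = (tperm x z ^ sbar (ordS z))%g.
    by rewrite tpermJ sz tpermL tpermD // eq_sym.
  rewrite conjgE {1}sz tpermV -sz.
  by apply: (invM _ _ (hs _)); apply: (invM _ _ (IH x z erefl)); exact: hs.
have invtt x y : inv (tperm x y).
  by have [d] := iter_ordS_connected x y; exact: invt.
move=> w; have [ts -> _] := prod_tpermP w.
by elim/big_rec: _ => [|t u _ hu]; [exact: inv1 | apply: invM].
Qed.

(** * Stationary measures seen through sets of occupied sites *)

Section LumpedChain.
Variables (R : realFieldType) (m : nat) (p : R) (zeta : state m -> R).
Hypotheses (m_gt0 : (0 < m)%N) (p_gt0 : 0 < p) (p_lt1 : p < 1).
Hypothesis zeta_st : stationary p zeta.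
Implicit Types (w : 'S_m.+1) (c : 'I_m.+1) (A : {set 'I_m.+1}).

Lemma fw_sbar w c : @fw R m (w * sbar c)%g c = 1 - fw R w c.
Proof.
rewrite /fw /f0 !invMg !permM /sbar tpermV tpermL tpermR.
have : val ((w^-1)%g (ord_pred c)) != val ((w^-1)%g c).
  by rewrite (inj_eq val_inj) (inj_eq perm_inj) ord_pred_neq.
by case: ltngtP => // _ _; rewrite ?subr0 ?subrr.
Qed.

Lemma stationary_step w c :
  zeta (w, ordS c) = zeta (w, c) - p * (zeta (w, c) * fw R w c)
    + p * (zeta ((w * sbar c)%g, c) * fw R (w * sbar c)%g c).
Proof.
have [_ _ /(_ (w, ordS c)) <-] := zeta_st.
have sK u : (u * sbar c * sbar c = u)%g by rewrite -mulgA tperm2 mulg1.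
(* Only two states can lead to [(w, ordS c)]: [(w, c)] by staying and [(w * sbar c, c)] by
   swapping. *)
rewrite (bigD1 (w, c)) //= (bigD1 ((w * sbar c)%g, c)) /=; last first.
  rewrite xpair_eqE eqxx andbT -{2}(mulg1 w) (inj_eq (mulgI _)).
  apply/eqP => /permP /(_ c); rewrite /sbar tpermR perm1.
  by apply/eqP/ord_pred_neq.
rewrite big1 => [|[u d] /= /andP[ne1 ne2]].
  rewrite !xpair_eqE !eqxx !andbT sK eqxx.
  have -> : (w == w * sbar c)%g = false.
    rewrite eq_sym -{2}(mulg1 w) (inj_eq (mulgI _)).
    apply/eqP => /permP /(_ c); rewrite /sbar tpermR perm1.
    by apply/eqP/ord_pred_neq.
  by ring.
rewrite !xpair_eqE (inj_eq (@ordS_inj _)).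
have [cd|] := eqVneq c d; last by rewrite !andbF addr0 mulr0.
rewrite -cd !xpair_eqE !eqxx !andbT in ne1 ne2 *.
rewrite (eq_sym w u) (negbTE ne1) -(inj_eq (mulIg (sbar c))) sK eq_sym.
by rewrite (negbTE ne2) addr0 mulr0.
Qed.

(** An update only moves mass between permutations: the loss and gain terms cancel after reindexing
    by [sbar d], so all [n] values of the second coordinate have equal mass. *)
Lemma mass_const c : m.+1%:R * (\sum_w zeta (w, c)) = 1.
Proof.
have step d : \sum_w zeta (w, ordS d) = \sum_w zeta (w, d).
  under eq_bigr do rewrite stationary_step.
  rewrite big_split sumrB /=.
  rewrite (reindex_inj (mulIg (sbar d))) /=.
  rewrite [X in _ - X + _](reindex_inj (mulIg (sbar d))) /=.
  by rewrite addrNK.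
have [_ z1 _] := zeta_st; rewrite -[RHS]z1.
rewrite (eq_bigr (fun x => zeta (x.1, x.2))); last by case.
rewrite -(pair_bigA _ (fun w d => zeta (w, d))) exchange_big /=.
rewrite [RHS](eq_bigr (fun=> \sum_w zeta (w, c))) => [|d _].
  by rewrite sumr_const card_ord mulr_natl.
exact: (ordS_invariant step).
Qed.

Variable k : nat.

(** A permutation sends types to sites, so [w @: occ] is the set of sites carrying one of the [k]
    smallest types. *)
Definition occ : {set 'I_m.+1} := [set j : 'I_m.+1 | (j < k)%N].

Definition lump A c := \sum_(w : 'S_m.+1 | w @: occ == A) zeta (w, c).

Definition flux A c :=
  \sum_(w : 'S_m.+1 | w @: occ == A) zeta (w, c) * fw R w c.

Lemma lump_step A c :
  lump A (ordS c) = lump A c - p * flux A c + p * flux (sbar c @: A) c.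
Proof.
rewrite /lump; under eq_bigr do rewrite stationary_step.
rewrite big_split sumrB -!mulr_sumr /=; congr (_ + p * _).
rewrite /flux [RHS](reindex_inj (mulIg (sbar c))) /=; apply: eq_bigl => w.
by rewrite imset_permM (inj_eq (imset_inj perm_inj)).
Qed.

(** Every [w] in the class of [A] has its type at [c] below [k] and its type at [ord_pred c] at
    least [k], so the swap is allowed whatever the exact types are. *)
Lemma flux_hole_particle A c :
  ord_pred c \notin A -> c \in A -> flux A c = lump A c.
Proof.
move=> hp hc; apply: eq_bigr => w /eqP wA; move: hp hc.
rewrite -wA !mem_imset_perm !inE -leqNgt /fw /f0 => hp hc.
by rewrite (leq_trans hc hp) mulr1.
Qed.

Lemma flux_particle_hole A c :
  ord_pred c \in A -> c \notin A -> flux A c = 0.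
Proof.
move=> hp hc; apply: big1 => w /eqP wA; move: hp hc.
rewrite -wA !mem_imset_perm !inE -leqNgt /fw /f0 => hp hc.
by rewrite ltnNge (ltnW (leq_trans hp hc)) mulr0.
Qed.

(* The stationary weight of the lumped chain when the bond (c - 1, c) is about
   to be updated. *)
Definition wt A c : R := if ord_pred c \in A then 1 - p else 1.

Definition dens A c := lump A c / wt A c.

Let q_neq0 : 1 - p != 0. Proof. by rewrite subr_eq0 gt_eqF. Qed.

Lemma wt_neq0 A c : wt A c != 0.
Proof. by rewrite /wt; case: ifP => // _; rewrite oner_eq0. Qed.

Lemma mem_sbar_pred A c : (ord_pred c \in sbar c @: A) = (c \in A).
Proof. by rewrite mem_imset_perm tpermV tpermL. Qed.

Lemma mem_sbar A c : (c \in sbar c @: A) = (ord_pred c \in A).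
Proof. by rewrite mem_imset_perm tpermV tpermR. Qed.

Lemma dens_step A c :
  dens A (ordS c) = if (ord_pred c \in A) && (c \notin A)
                    then (1 - p) * dens A c + p * dens (sbar c @: A) c
                    else dens A c.
Proof.
rewrite /dens lump_step /wt ordSK mem_sbar_pred.
case: (boolP (ord_pred c \in A)) => hp; case: (boolP (c \in A)) => hc /=.
(* When both sites are occupied, the flux depends on more than [A], but the swap fixes [A] and the
   two flux terms cancel; likewise when both are empty. *)
- by rewrite imset_tperm_id ?hp ?hc // addrNK.
- rewrite flux_particle_hole // flux_hole_particle ?mem_sbar ?mem_sbar_pred //.
  by field.
- rewrite flux_hole_particle //.
  rewrite [flux (_ @: _) _]flux_particle_hole ?mem_sbar ?mem_sbar_pred //.
  by field.
- by rewrite imset_tperm_id ?(negbTE hp) ?(negbTE hc) // addrNK.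
Qed.

(** On a particle-hole pair one density becomes a convex combination of both, and the energy lost is
    the variance of a two-point law with weights [1 - p] and [p]. *)
Lemma energy_step A c :
  (wt A c * dens A c ^+ 2 - wt A (ordS c) * dens A (ordS c) ^+ 2)
  + (wt (sbar c @: A) c * dens (sbar c @: A) c ^+ 2
     - wt (sbar c @: A) (ordS c) * dens (sbar c @: A) (ordS c) ^+ 2)
  = p * (1 - p) * (dens A c - dens (sbar c @: A) c) ^+ 2.
Proof.
rewrite !dens_step imset_tpermK /wt ordSK mem_sbar_pred mem_sbar.
case: (boolP (ord_pred c \in A)) => hp; case: (boolP (c \in A)) => hc /=.
- by rewrite imset_tperm_id ?hp ?hc //; ring.
- by ring.
- by ring.
- by rewrite imset_tperm_id ?(negbTE hp) ?(negbTE hc) //; ring.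
Qed.

Lemma dens_sbar A c : dens (sbar c @: A) c = dens A c.
Proof.
pose E c := \sum_A wt A c * dens A c ^+ 2.
pose D c := \sum_A p * (1 - p) * (dens A c - dens (sbar c @: A) c) ^+ 2.
have q0 : 0 < 1 - p by rewrite subr_gt0.
have D_ge0 B d : 0 <= p * (1 - p) * (dens B d - dens (sbar d @: B) d) ^+ 2.
  by rewrite mulr_ge0 ?sqr_ge0 // mulr_ge0 ?ltW.
(* The factor 2 arises because [A] and [sbar d @: A] both range over all sets. *)
have DE d : D d = 2 * (E d - E (ordS d)).
  rewrite /D; under eq_bigr do rewrite -energy_step.
  rewrite big_split /=.
  rewrite [X in _ + X](reindex_inj (imset_inj (@perm_inj _ (sbar d)))) /=.
  under [X in _ + X]eq_bigr do rewrite imset_tpermK.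
  by rewrite sumrB /E; ring.
(* The energy losses telescope around the cycle of bonds; being nonnegative, they all vanish. *)
have D0 : \sum_d D d = 0.
  under eq_bigr do rewrite DE.
  rewrite -mulr_sumr sumrB [X in _ - X](_ : _ = \sum_d E d) ?subrr ?mulr0 //.
  by rewrite [RHS](reindex_inj (@ordS_inj m.+1)).
have /psumr_eq0P/(_ D0) Dc : forall d, true -> 0 <= D d.
  by move=> d _; apply: sumr_ge0 => B _.
have /psumr_eq0P/(_ (Dc c erefl))/(_ A erefl) : forall B, true -> 0 <= _ :=
  fun B _ => D_ge0 B c.
move/eqP; rewrite 2!mulf_eq0 sqrf_eq0 (gt_eqF p_gt0) (gt_eqF q0) subr_eq0 /=.
by move/eqP.
Qed.

Lemma dens_const (A B : {set 'I_m.+1}) c d : #|A| = #|B| -> dens A c = dens B d.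
Proof.
move=> AB.
have densS C b : dens C (ordS b) = dens C b.
  by rewrite dens_step dens_sbar; case: ifP => // _; ring.
have [w <-] := exists_imset_perm AB.
rewrite (@invariant_adjacent _ _ (fun C => dens C d)) => [|b C].
  exact: (ordS_invariant (densS A)).
rewrite (ordS_invariant (densS _) d b) dens_sbar.
exact: (ordS_invariant (densS C)).
Qed.

Hypothesis k_le : (k <= m.+1)%N.

Lemma card_occ : #|occ| = k.
Proof.
rewrite -sum1_card (eq_bigl (fun j : 'I_m.+1 => (j < k)%N)) => [|j].
  by rewrite -(big_ord_widen m.+1 (fun=> 1%N) k_le) sum1_card card_ord.
by rewrite inE.
Qed.

(** Probabilities of events depending only on the occupied set reduce to weighted counts of
    [k]-subsets, up to one common constant. *)
Lemma sum_lump (Q : pred {set 'I_m.+1}) c :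
  \sum_(w : 'S_m.+1 | Q (w @: occ)) zeta (w, c)
  = dens occ c * \sum_(A | Q A && (#|A| == k)) wt A c.
Proof.
rewrite (partition_big (fun w : 'S_m.+1 => w @: occ)
  (fun A => Q A && (#|A| == k))) => [|w ->].
  rewrite mulr_sumr; apply: eq_bigr => A /andP[QA /eqP cA].
  rewrite (@dens_const occ A c c) ?card_occ // divfK ?wt_neq0 //.
  by apply: eq_bigl => w; case: eqP => [->|]; rewrite ?QA ?andbF.
by rewrite card_imset ?card_occ ?eqxx //; exact: perm_inj.
Qed.

End LumpedChain.

(** * Closed forms for the coordinates of both vectors *)

Section Flow.
Variables (R : realFieldType) (m : nat) (p : R) (zeta : state m -> R).

Definition flow k :=
  \sum_(w : 'S_m.+1 | ((w^-1)%g ord0 < k <= (w^-1)%g ord_max)%N) zeta (w, ord0).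

Lemma psi_coord i : psi zeta 0 i = flow i.+1 - flow i.
Proof.
rewrite /psi summxE /flow.
rewrite (big_mkcond (fun w : 'S_m.+1 => (_ < _)%N)).
rewrite [X in X - _]big_mkcond [X in _ - X]big_mkcond -sumrB.
apply: eq_bigr => w _; rewrite !mxE !eqxx /=.
set a := (w^-1)%g ord0; set b := (w^-1)%g ord_max.
rewrite -!(inj_eq val_inj) /= ltnS.
move: (val a) (val b) (val i) => {}a {}b {}i.
case: (ltngtP a i) => ai; case: (ltngtP b i) => bi /=; case: (ltnP a b) => ab /=;
  by rewrite ?subrr ?subr0 ?sub0r ?mulr0 ?mulr1 ?mulrN1 //; lia.
Qed.

Hypotheses (m_gt0 : (0 < m)%N) (p_gt0 : 0 < p) (p_lt1 : p < 1).
Hypothesis zeta_st : stationary p zeta.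

Lemma gap_gt0 k : (k <= m.+1)%N -> 0 < (m.+1%:R - k%:R * p : R).
Proof.
move=> km; rewrite subr_gt0; apply: (@le_lt_trans _ _ (m.+1%:R * p)).
  by rewrite ler_pM2r // ler_nat.
by rewrite gtr_pMr ?ltr0n.
Qed.

(** With [k = j.+1], both the flow and the total mass [1 / n] at [ord0] are multiples of the same
    density [H]; their ratio is a ratio of binomial counts. *)
Lemma flowE k : (k <= m.+1)%N ->
  flow k = (k%:R * (m.+1%:R - k%:R)) / (m.+1%:R * m%:R * (m.+1%:R - k%:R * p)).
Proof.
rewrite leq_eqVlt => /orP[/eqP ->|].
  rewrite subrr mulr0 mul0r; apply: big1 => w /andP[_ ].
  by rewrite leqNgt ltn_ord.
case: k => [_|j]; first by rewrite !mul0r; apply: big1 => w.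
rewrite ltnS => jm; have km : (j.+1 <= m.+1)%N by exact: leqW.
have := mass_const m_gt0 zeta_st ord0.
pose H := dens p zeta j.+1 (occ m j.+1) ord0.
have -> : flow j.+1 = H * ('C(m.-1, j))%:R.
  rewrite /flow (eq_bigl (fun w : 'S_m.+1 =>
    (ord0 \in w @: occ m j.+1) && (ord_max \notin w @: occ m j.+1))).
    rewrite (sum_lump m_gt0 p_gt0 p_lt1 zeta_st km
      (fun A => (ord0 \in A) && (ord_max \notin A))).
    congr (_ * _).
    rewrite (eq_bigr (fun=> 1)) => [|A /andP[/andP[_ hA] _]]; last first.
      by rewrite /wt ord_pred0 (negbTE hA).
    have := @card_draws_in _ [set~ (ord_max : 'I_m.+1)] ord0 j.
    rewrite sumr_const cardsC1 card_ord => <-.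
      by congr (_%:R); rewrite -cardsE; apply: eq_card => A;
        rewrite !inE subset_setC1 andbA.
    by rewrite !inE -(inj_eq val_inj) /= eq_sym -lt0n.
  by move=> w; rewrite !mem_imset_perm !inE -leqNgt.
rewrite (sum_lump m_gt0 p_gt0 p_lt1 zeta_st km predT) -/H.
rewrite (bigID (fun A : {set 'I_m.+1} => ord_max \in A)) /=.
rewrite (eq_bigr (fun=> 1 - p)) => [|A /andP[_ hA]]; last first.
  by rewrite /wt ord_pred0 hA.
rewrite [X in _ + X](eq_bigr (fun=> 1)) => [|A /andP[_ hA]]; last first.
  by rewrite /wt ord_pred0 (negbTE hA).
rewrite !sumr_const.
rewrite (_ : #|_| = 'C(m, j)); last first.
  have := @card_draws_in _ [set: 'I_m.+1] ord_max j (in_setT _).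
  rewrite cardsT card_ord => <-; rewrite -[LHS]cardsE.
  by apply: eq_card => A; rewrite !inE subsetT andbC.
rewrite (_ : #|[pred A | _ & _]| = 'C(m, j.+1)); last first.
  have := cards_draws [set~ (ord_max : 'I_m.+1)] j.+1.
  rewrite cardsC1 card_ord => <-; rewrite -[LHS]cardsE.
  by apply: eq_card => A; rewrite !inE subset_setC1 andbC.
(* Both binomials in the normalisation are rational multiples of ['C(m.-1, j)], which therefore
   cancels. *)
have := congr1 (fun x => x%:R : R) (mul_bin_diag m j).
have := congr1 (fun x => x%:R : R) (mul_bin_down m j).
rewrite !natrM natrB ?(ltnW jm) // -(mulr_natr (1 - p)).
set C := 'C(m.-1, j)%:R; set C1 := 'C(m, j)%:R; set C2 := 'C(m, j.+1)%:R.
move=> e1 e2 e3.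
have n0 : m.+1%:R != 0 :> R by rewrite pnatr_eq0.
have m0 : m%:R != 0 :> R by rewrite pnatr_eq0 -lt0n.
have g0 := lt0r_neq0 (gap_gt0 km).
have d0 : m.+1%:R * m%:R * (m.+1%:R - j.+1%:R * p) != 0 by rewrite !mulf_neq0.
apply: (mulIf d0); rewrite divfK //.
rewrite -[RHS]mulr1 -[X in _ = _ * X]e3.
have -> : m.+1%:R - j.+1%:R = m%:R - j%:R :> R by rewrite -!natr1; ring.
rewrite [RHS](_ : _ = m.+1%:R * H
  * ((1 - p) * j.+1%:R * ((m%:R - j%:R) * C1)
     + (m%:R - j%:R) * (j.+1%:R * C2))); last by ring.
rewrite -e1 -e2 -!natr1; ring.
Qed.

Lemma inv_gap_diff b : (b < m.+1)%N ->
  ((m.+1%:R - b.+1%:R * p) * (m.+1%:R - b%:R * p))^-1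
  = p^-1 * ((m.+1%:R - b.+1%:R * p)^-1 - (m.+1%:R - b%:R * p)^-1).
Proof.
move=> bm; have g1 := lt0r_neq0 (gap_gt0 bm).
have g0 := lt0r_neq0 (gap_gt0 (ltnW bm)).
have p0 := lt0r_neq0 p_gt0.
rewrite -(natr1 b) in g1 *; move: g0 g1.
by move: (m.+1%:R) (b%:R) => n x g0 g1; field; rewrite p0 g0 g1.
Qed.

(** The coefficients [F] are antisymmetric, so coordinate [i] is the full row sum of [F i b] over
    [b], where the sum of [D b] telescopes. *)
Lemma target_coord (i : 'I_m.+1) :
  target m p 0 i = p^-1 * ((m.+1%:R * (1 - p))^-1
    - m.+1%:R / ((m.+1%:R - i.+1%:R * p) * (m.+1%:R - i%:R * p))).
Proof.
pose D b : R := ((m.+1%:R - b.+1%:R * p) * (m.+1%:R - b%:R * p))^-1.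
pose F (a b : 'I_m.+1) := p^-1 * (D b - D a).
have p0 := lt0r_neq0 p_gt0.
have sumD : \sum_(b < m.+1) D b = (m.+1%:R * (1 - p))^-1.
  rewrite (eq_bigr (fun b : 'I_m.+1 =>
    p^-1 * ((m.+1%:R - b.+1%:R * p)^-1 - (m.+1%:R - b%:R * p)^-1))); last first.
    by move=> b _; rewrite /D inv_gap_diff.
  rewrite -mulr_sumr -(big_mkord xpredT (fun b =>
    (m.+1%:R - b.+1%:R * p)^-1 - (m.+1%:R - b%:R * p)^-1)).
  rewrite (telescope_sumr (fun b => (m.+1%:R - b%:R * p)^-1)) // mul0r subr0.
  have n0 : m.+1%:R != 0 :> R by rewrite pnatr_eq0.
  have := lt0r_neq0 (gap_gt0 (leqnn m.+1)).
  move: (m.+1%:R : R) n0 => n n0 g0.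
  have q0 : 1 - p != 0 by rewrite subr_eq0 gt_eqF.
  by field; rewrite p0 n0 g0 q0.
transitivity (\sum_b F i b); last first.
  by rewrite -mulr_sumr sumrB sumr_const card_ord sumD -[X in _ - X]mulr_natl.
have -> : target m p =
    \sum_(a < m.+1) \sum_(b < m.+1 | (a < b)%N) F a b *: (e R a - e R b).
  apply: eq_bigr => a _; apply: eq_bigr => b ab; congr (_ *: _).
  have g0 c : (c <= m.+1)%N -> m.+1%:R - c%:R * p != 0.
    by move=> cm; exact: lt0r_neq0 (gap_gt0 cm).
  rewrite /F /D addnS subn1 /= addSn.
  have := g0 a (ltnW (ltn_ord a)); have := g0 a.+1 (ltn_ord a).
  have := g0 b (ltnW (ltn_ord b)); have := g0 b.+1 (ltn_ord b).
  rewrite -!natr1 natrD.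
  move: (m%:R : R) (a%:R : R) (b%:R : R) => n x y h1 h2 h3 h4.
  by field; rewrite p0 h1 h2 h3 h4.
rewrite summxE.
transitivity (\sum_(a < m.+1) \sum_(b < m.+1 | (a < b)%N)
  (F a b * (i == a)%:R - F a b * (i == b)%:R)).
  apply: eq_bigr => a _; rewrite summxE; apply: eq_bigr => b _.
  by rewrite !mxE eqxx /= mulrBr.
under eq_bigr do rewrite sumrB.
rewrite sumrB [X in _ - X](exchange_big_dep xpredT) //=.
rewrite (bigD1 i) //= [X in _ + X - _]big1 => [|a ai]; last first.
  by apply: big1 => b _; rewrite eq_sym (negbTE ai) mulr0.
rewrite [X in _ - X](bigD1 i) //= [X in _ - (_ + X)]big1 => [|a ai]; last first.
  by apply: big1 => b _; rewrite eq_sym (negbTE ai) mulr0.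
rewrite !addr0 eqxx [RHS](bigID (fun b : 'I_m.+1 => (i < b)%N)) /=; congr (_ + _).
  by apply: eq_bigr => b _; rewrite mulr1.
(* Antisymmetry turns the subtracted terms [F b i] with [b < i] into [F i b]; the diagonal term is
   zero. *)
rewrite -sumrN [RHS](bigD1 i) ?ltnn //=.
have -> : F i i = 0 by rewrite /F subrr mulr0.
rewrite add0r; apply: eq_big => [b|b _]; last by rewrite /F; ring.
by rewrite -leqNgt ltn_neqAle andbC.
Qed.

End Flow.

(* n = m.+1 with n >= 2 *)
Theorem theorem1p5 (R : realFieldType) (m : nat) (hm : (1 <= m)%N) (p : R)
    (hp0 : 0 < p) (hp1 : p < 1) (zeta : state m -> R) :
  stationary p zeta ->
  exists2 c : R, 0 < c & psi zeta = c *: target m p.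
Proof.
(* The constant is read off the first coordinates, [1 / (n (n - p))] for [psi] and
   [m / (n (1 - p) (n - p))] for the target. *)
move=> zeta_st; exists ((1 - p) / m%:R).
  by rewrite divr_gt0 ?subr_gt0 ?ltr0n.
apply/rowP => i; rewrite mxE psi_coord target_coord //.
rewrite !(flowE hm hp0 hp1 zeta_st) ?(ltnW (ltn_ord i)) //.
have := lt0r_neq0 (gap_gt0 hp0 hp1 (ltn_ord i)).
have := lt0r_neq0 (gap_gt0 hp0 hp1 (ltnW (ltn_ord i))).
have m0 : m%:R != 0 :> R by rewrite pnatr_eq0 -lt0n.
have n0 : m.+1%:R != 0 :> R by rewrite pnatr_eq0.
have p0 := lt0r_neq0 hp0.
have q0 : 1 - p != 0 by rewrite subr_eq0 gt_eqF.
move: m0 n0; rewrite -!natr1.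
move: (m%:R : R) ((i : nat)%:R : R) => n x n0 n1 g0 g1.
by field; rewrite p0 q0 n0 n1 g0 g1.
Qed.
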